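(* Let $m\ge 2$ and $n=(3^m-1)/2$. The set of ternary $1$-perfect codes of length $n$ of rank at most $+1$ (that is, of rank at most $n-m+1$) is connected with respect to two-coordinate switching: for any two codes $C,C'$ in this set there is a finite sequence $C=C_0,C_1,\ldots,C_k=C'$ of codes in this set such that $C_{l+1}$ is a two-coordinate switching of $C_l$ for every $l=0,\ldots,k-1$.
   Context: The Hamming graph $H(n,3)$ has vertex set $\mathbb{F}_3^n=\{0,1,2\}^n$, two words being adjacent iff they differ in exactly one position. A $1$-perfect code is a set of pairwise non-adjacent vertices such that every vertex not in the set is adjacent to exactly one element of the set. The rank of a code is the dimension of its affine span over $\mathbb{F}_3$; a $1$-perfect code of length $n=(3^m-1)/2$ has rank $+r$ if its rank is $(n-m)+r$. Every automorphism of $H(n,3)$ is uniquely a composition of a coordinate permutation $\pi$ and an isotopy $\bar\theta=(\theta_0,\ldots,\theta_{n-1})$ (permutations of the alphabet $\{0,1,2\}$ acting independently in the coordinates). For $1$-perfect codes $C,C'$ of length $n$, the code $C'$ is a two-coordinate switching of $C$ if there are two coordinates $i,j$ and an automorphism $\beta=(\pi,\bar\theta)$ of $H(n,3)$ such that $\pi$ fixes all coordinates except maybe $i$ and $j$, $\theta_l$ is the identity for all $l\notin\{i,j\}$, and $C'\subset C\cup\beta(C)$. *)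

(* Defs.v *)
From HB Require Import structures.
From mathcomp Require Import all_boot all_order all_fingroup all_algebra.

Set Implicit Arguments.
Unset Strict Implicit.
Unset Printing Implicit Defensive.

Import GRing.Theory.

Local Open Scope ring_scope.

Definition hadj (n : nat) (x y : 'rV['F_3]_n) : bool :=
  #|[set i : 'I_n | x 0 i != y 0 i]| == 1%N.

Definition perfect1 (n : nat) (C : {set 'rV['F_3]_n}) : Prop :=
  {in C &, forall x y, ~~ hadj x y} /\
  (forall x, x \notin C -> #|[set c in C | hadj x c]| = 1%N).

Definition affine_span (n : nat) (C : {set 'rV['F_3]_n}) : {set 'rV['F_3]_n} :=
  [set x | [exists a : {ffun 'rV['F_3]_n -> 'F_3},
     (\sum_(c in C) a c == 1) && (x == \sum_(c in C) a c *: c)]].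

Definition direction (n : nat) (A : {set 'rV['F_3]_n}) : {vspace 'rV['F_3]_n} :=
  <<[seq x - y | x <- enum A, y <- enum A]>>%VS.

(* The dimension of an affine subspace is that of its direction. *)
Definition code_rank (n : nat) (C : {set 'rV['F_3]_n}) : nat :=
  \dim (direction (affine_span C)).

(* The letter in coordinate l is moved to coordinate p l, and then theta k is
   applied to the letter in coordinate k. *)
Definition hamming_aut (n : nat) (p : {perm 'I_n})
    (theta : {ffun 'I_n -> {perm 'F_3}}) (x : 'rV['F_3]_n) : 'rV['F_3]_n :=
  \row_k theta k (x 0 ((p^-1)%g k)).

Definition two_coord_switching (n : nat) (C C' : {set 'rV['F_3]_n}) : Prop :=
  exists (i j : 'I_n) (p : {perm 'I_n}) (theta : {ffun 'I_n -> {perm 'F_3}}),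
    [/\ i != j,
        forall l, l \notin [set i; j] -> p l = l,
        forall l, l \notin [set i; j] -> theta l = 1%g
      & C' \subset C :|: [set hamming_aut p theta x | x in C]].

(* Main.v *)
(* A code C of rank at most +1 lies in a flat {x | x K = s} with K of full rank
   m - 1.  Counting pairs (c, x) with c in C, x in the ball of c and x in a
   translate of the flat shows that exactly one row z of K vanishes and that, up
   to sign, every nonzero vector occurs as a row exactly three times.  Hence C is
   the graph, over the other coordinates, of a function giving coordinate z, and
   along two coordinates of one block (three rows equal up to sign) this function
   takes distinct values.  Latin squares of order 3 being affine, the increment of
   the function along e_i - e_j is constant on the cosets of the span of all such
   differences and of e_z, so it can be corrected on any union of such cosets by
   swapping i and j there; the remaining constants are corrected by shifting
   coordinate z.  This links C to an affine code depending only on K and s.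
   Finally, sign changes, transpositions and translations link any (K, s) to any
   other. *)
Require Import Defs.
From mathcomp Require Import all_boot all_order all_fingroup all_algebra.
From mathcomp Require Import zify ring.

Set Implicit Arguments.
Unset Strict Implicit.
Unset Printing Implicit Defensive.

Import GRing.Theory.

(** * Arithmetic of the field with three elements *)

Section TernaryField.
Local Open Scope ring_scope.

Lemma F3_ind (P : 'F_3 -> Prop) : P 0 -> P 1 -> P (-1) -> forall a, P a.
Proof.
move=> P0 P1 P2 [[|[|[|//]]] lt_a]; [move: P0|move: P1|move: P2];
  by congr (P _); apply: val_inj.
Qed.

(** The three letters sum to 0. *)
Lemma F3_third (a b c : 'F_3) : a != b -> b != c -> a != c -> c = - a - b.
Proof. by elim/F3_ind: a; elim/F3_ind: b; elim/F3_ind: c => // *; apply: val_inj. Qed.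

Lemma F3_translates (a b : 'F_3) :
  b != 0 -> [|| a == 0, a + b == 0 | a - b == 0].
Proof. by elim/F3_ind: a; elim/F3_ind: b. Qed.

(** The differences [F a 1 - F a 0] are nonzero and sum to 0 over the three values of [a]. If two of
    them differed by d != 0, the three would be c, c + d and c - d, one of which vanishes. *)
Lemma F3_latin (F : 'F_3 -> 'F_3 -> 'F_3) :
    (forall a a' b, a != a' -> F a b != F a' b) ->
    (forall a b b', b != b' -> F a b != F a b') ->
  F 1 1 - F 0 1 = F 1 0 - F 0 0.
Proof.
move=> latl latr; apply/eqP; rewrite -subr_eq0; apply/negPn/negP => nz.
have third b : F (-1) b = - F 0 b - F 1 b by apply: F3_third; apply: latl.
have col a : F a 1 - F a 0 != 0 by rewrite subr_eq0 latr.
have /or3P[]:= F3_translates (F 0 1 - F 0 0) nz; apply/negP.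
- exact: col.
- by rewrite (_ : _ + _ = F 1 1 - F 1 0) ?col //; ring.
- have := col (-1); rewrite !third; congr (_ != 0).
  (* The surplus term is a multiple of 3, hence vanishes in the field. *)
  have -> : F 0 1 - F 0 0 - (F 1 1 - F 0 1 - (F 1 0 - F 0 0)) =
     - F 0 1 - F 1 1 - (- F 0 0 - F 1 0) + 3%:R * (F 0 1 - F 0 0) by ring.
  by rewrite (_ : 3%:R = 0) ?mul0r ?addr0 //; apply: val_inj.
Qed.

End TernaryField.

(** * Balls of radius 1, and perfect codes as exact coverings *)

Section Balls.
Local Open Scope ring_scope.
Variable n : nat.
Implicit Types (x y c u : 'rV['F_3]_n) (C S A : {set 'rV['F_3]_n}) (i j : 'I_n).

Definition hdist x y := #|[set i | x 0 i != y 0 i]|.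

Definition ball x := [set y | (hdist x y <= 1)%N].

Definition unit_row i : 'rV['F_3]_n := delta_mx 0 i.
Local Notation e := unit_row.

Lemma hdist_sym x y : hdist x y = hdist y x.
Proof. by apply: eq_card => i; rewrite !inE eq_sym. Qed.

Lemma hdist0 x y : (hdist x y == 0%N) = (x == y).
Proof.
rewrite cards_eq0; apply/eqP/eqP => [/setP xy|->]; last first.
  by apply/setP => i; rewrite !inE eqxx.
by apply/rowP => i; have:= xy i; rewrite !inE => /negbFE/eqP.
Qed.

Lemma hdistxx x : hdist x x = 0%N.
Proof. by apply/eqP; rewrite hdist0. Qed.

Lemma hdist_sub x y u : hdist (x + u) (y + u) = hdist x y.
Proof. by apply: eq_card => i; rewrite !inE !mxE (inj_eq (addIr _)). Qed.

Lemma ball_sym x y : (y \in ball x) = (x \in ball y).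
Proof. by rewrite !inE hdist_sym. Qed.

Lemma ball_refl x : x \in ball x.
Proof. by rewrite inE hdistxx. Qed.

Lemma mem_ball_scale x i t : x + t *: e i \in ball x.
Proof.
rewrite inE -[leqRHS](cards1 i); apply: subset_leq_card.
apply/subsetP => j; rewrite !inE !mxE eqxx /=; apply: contraR => /negPf ->.
by rewrite mulr0 addr0.
Qed.

Lemma ballP (n_gt0 : (0 < n)%N) x y :
  reflect (exists i t, y = x + t *: e i) (y \in ball x).
Proof.
apply: (iffP idP) => [|[i [t ->]]]; last exact: mem_ball_scale.
rewrite inE leq_eqVlt ltnS leqn0 => /orP[/cards1P[i xyi]|]; last first.
  (* The centre is written with coefficient 0 at an arbitrary coordinate, which exists because [n]
     is positive. *)
  rewrite hdist0 => /eqP ->; exists (Ordinal n_gt0), 0.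
  by rewrite scale0r addr0.
exists i, (y 0 i - x 0 i); apply/rowP => j; rewrite !mxE eqxx /=.
have := in_set1 j i; rewrite -xyi inE; have [->|_] := eqVneq j i.
  by rewrite mulr1 addrC subrK.
by move/negbFE/eqP ->; rewrite mulr0 addr0.
Qed.

(** Besides the centre there is one word for each coordinate and each of the two nonzero letters. *)
Lemma card_ball0 : (0 < n)%N -> #|ball 0| = (2 * n).+1.
Proof.
move=> n_gt0; pose N := setX [set: 'I_n] [set t : 'F_3 | t != 0].
have -> : ball 0 = 0 |: [set p.2 *: e p.1 | p in N].
  apply/setP => x; rewrite !inE.
  apply/idP/idP => [x_ball|/orP[/eqP ->|/imsetP[[i t] _ ->]]]; last first.
  - by have := mem_ball_scale 0 i t; rewrite add0r inE.
  - by have := ball_refl 0; rewrite inE.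
  have /(ballP n_gt0)[i [t ->]] : x \in ball 0 by rewrite inE.
  rewrite add0r; have [->|nz] := eqVneq t 0; first by rewrite scale0r eqxx.
  by apply/orP; right; apply/imsetP; exists (i, t) => //; rewrite !inE.
have ev i t j : (t *: e i) 0 j = if j == i then t else 0.
  by rewrite !mxE eqxx; case: eqVneq => _; rewrite ?mulr1 ?mulr0.
rewrite cardsU1 card_in_imset; last first.
  move=> [i t] [j u]; rewrite !inE /= => nzt nzu /rowP eq_tu.
  have := eq_tu i; rewrite !ev eqxx; case: eqVneq => [-> -> //|_ t0].
  by rewrite t0 eqxx in nzt.
have -> : 0 \notin [set p.2 *: e p.1 | p in N].
  apply/negP => /imsetP[[i t]]; rewrite !inE /= => nzt /rowP/(_ i).
  by rewrite ev eqxx mxE => t0; rewrite -t0 eqxx in nzt.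
rewrite cardsX cardsT card_ord.
have -> : #|[set t : 'F_3 | t != 0]| = 2%N.
  have -> : [set t : 'F_3 | t != 0] = ~: [set 0] by apply/setP => t; rewrite !inE.
  by rewrite cardsC1 card_Fp.
by rewrite mulnC.
Qed.

(** A form of 1-perfectness that treats words inside and outside the code alike, which suits
    counting and mixing. *)
Definition packed C := forall x, #|C :&: ball x| = 1%N.

(** Off the code, the codewords in a ball are exactly the neighbours of its centre. In a ball
    centred at a codeword, any second codeword would be adjacent to the centre. *)
Lemma perfect1P C : perfect1 C <-> packed C.
Proof.
have adjE x : x \notin C -> [set c in C | hadj x c] = C :&: ball x.
  move=> xC; apply/setP => c; rewrite !inE leq_eqVlt ltnS leqn0 hdist0.
  case: (boolP (c \in C)) => //= cC; case: (eqVneq x c) => [xc|]; last by rewrite orbF.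
  by rewrite xc cC in xC.
split=> [[indep dom] x|pkC].
  have [xC|xC] := boolP (x \in C); last by rewrite -adjE // dom.
  rewrite (_ : C :&: ball x = [set x]) ?cards1 //; apply/setP => c.
  rewrite !inE leq_eqVlt ltnS leqn0 hdist0 [c == x]eq_sym.
  have [<-|_] := eqVneq x c; first by rewrite xC orbT.
  by rewrite orbF; apply/negP => /andP[cC]; apply/negP/indep.
split=> [x y xC yC|x xC]; last by rewrite adjE.
apply/negP => adj; have /eqP/cards1P[c xc] := pkC x.
have: x \in C :&: ball x by rewrite inE xC ball_refl.
have: y \in C :&: ball x by rewrite inE yC inE /hdist (eqP adj).
rewrite xc !inE => /eqP yc /eqP xc'; move: adj; rewrite yc xc'.
by rewrite [hadj _ _]/(hdist c c == 1%N) hdistxx.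
Qed.

Lemma packed_uniq C x c c' : packed C ->
  c \in C -> c' \in C -> c \in ball x -> c' \in ball x -> c = c'.
Proof.
move=> /(_ x)/eqP/cards1P[d dE] cC c'C cx c'x.
have: c \in C :&: ball x by rewrite in_setI cC.
have: c' \in C :&: ball x by rewrite in_setI c'C.
by rewrite dE !in_set1 => /eqP -> /eqP ->.
Qed.

Lemma packed_ex C x : packed C -> exists2 c, c \in C & c \in ball x.
Proof.
move=> /(_ x)/eqP/cards1P[d dE].
have /setIP[] : d \in C :&: ball x by rewrite dE set11.
by exists d.
Qed.

End Balls.

(** * Automorphisms, mixing of two codes, and chains of switchings *)

Section Automorphisms.
Local Open Scope ring_scope.
Variable n : nat.
Implicit Types (x y c u : 'rV['F_3]_n) (C D S A : {set 'rV['F_3]_n}) (i j : 'I_n).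
Implicit Types (p : {perm 'I_n}) (th : {ffun 'I_n -> {perm 'F_3}}).

Lemma hamming_autE p th x k : hamming_aut p th x 0 (p k) = th (p k) (x 0 k).
Proof. by rewrite mxE permK. Qed.

Lemma hdist_aut p th x y : hdist (hamming_aut p th x) (hamming_aut p th y) = hdist x y.
Proof.
rewrite /hdist -(card_imset [set i | x 0 i != y 0 i] (@perm_inj _ p)).
congr #|pred_of_set _|; apply/setP => i.
by rewrite -[i](permKV p) (mem_imset _ _ perm_inj) !inE !hamming_autE (inj_eq perm_inj).
Qed.

(** The isotopy of the inverse is reindexed by [p], because [hamming_aut] moves letters before
    changing them. *)
Definition aut_inv p th : {ffun 'I_n -> {perm 'F_3}} := [ffun k => (th (p k))^-1%g].

Lemma hamming_autK p th :
  cancel (hamming_aut p th) (hamming_aut p^-1%g (aut_inv p th)).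
Proof. by move=> x; apply/rowP => k; rewrite mxE invgK ffunE hamming_autE permK. Qed.

Lemma hamming_autVK p th :
  cancel (hamming_aut p^-1%g (aut_inv p th)) (hamming_aut p th).
Proof.
move=> x; apply/rowP => k; rewrite -[k](permKV p) hamming_autE mxE ffunE invgK permKV.
by rewrite permKV.
Qed.

Definition local_aut i j p th :=
  [/\ i != j, forall l, l \notin [set i; j] -> p l = l
    & forall l, l \notin [set i; j] -> th l = 1%g].

Lemma local_autV i j p th :
  local_aut i j p th -> local_aut i j p^-1%g (aut_inv p th).
Proof.
case=> ij pE thE; split=> // l lij; first by apply: (@perm_inj _ p); rewrite permKV pE.
by rewrite ffunE pE // thE // invg1.
Qed.

Lemma packed_aut p th C : packed C -> packed [set hamming_aut p th x | x in C].
Proof.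
move=> pkC x; apply: (etrans _ (pkC (hamming_aut p^-1%g (aut_inv p th) x))).
rewrite -[RHS](card_imset _ (can_inj (hamming_autK p th))).
congr #|pred_of_set _|; apply/setP => y; rewrite -[y](hamming_autVK p th).
rewrite inE !(mem_imset _ _ (can_inj (hamming_autK _ _))) !inE; congr (_ && (_ <= 1)%N).
by rewrite -{1}[x](hamming_autVK p th) hdist_aut.
Qed.

Definition mix C D S := (C :\: S) :|: (D :&: S).

(** No ball contains words of [A] on both sides of [S]. This is what allows a code to be replaced
    inside [S] only. *)
Definition separated A S := forall x a b,
  a \in A -> b \in A -> a \in ball x -> b \in ball x -> a \in S -> b \in S.

(** Within a given ball all words of [A] are in [S] or none is, so there the mixed code agrees with
    [D] or with [C]. *)
Lemma packed_mix A S C D : packed C -> packed D -> C \subset A -> D \subset A ->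
  separated A S -> packed (mix C D S).
Proof.
move=> pkC pkD /subsetP CA /subsetP DA sepS x.
have [/exists_inP[a /andP[aA ax] aS]|none] :=
    boolP [exists a in [pred a | (a \in A) && (a \in ball x)], a \in S].
  apply: (etrans _ (pkD x)); congr #|pred_of_set _|; apply/setP => b; rewrite !in_setI in_setU.
  rewrite in_setD in_setI; have [bx|_] := boolP (b \in ball x); last by rewrite !andbF.
  have [bA|bA] := boolP (b \in A).
    by rewrite (sepS x a b) // !andbT.
  have /negPf bC := contra (CA b) bA; have /negPf bD := contra (DA b) bA.
  by rewrite bC bD andbF.
apply: (etrans _ (pkC x)); congr #|pred_of_set _|; apply/setP => b; rewrite !in_setI in_setU.
rewrite in_setD in_setI; have [bx|_] := boolP (b \in ball x); last by rewrite !andbF.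
have [bA|bA] := boolP (b \in A); last first.
  have /negPf bC := contra (CA b) bA; have /negPf bD := contra (DA b) bA.
  by rewrite bC bD andbF.
move: none; rewrite negb_exists_in => /forall_inP/(_ b); rewrite !inE /= in bx *.
by rewrite bA bx => /(_ isT)/negPf ->; rewrite andbF orbF !andbT.
Qed.

Lemma mix_switching i j p th C S : local_aut i j p th ->
  two_coord_switching C (mix C [set hamming_aut p th x | x in C] S).
Proof.
case=> ij pE thE; exists i, j, p, th; split=> //.
by apply: setUSS; [apply: subsetDl|apply: subsetIl].
Qed.

(** Stability of [S] puts the image of each word of [C] in [S] into the mixed code, and the inverse
    automorphism brings that word back. *)
Lemma mix_switchingV i j p th C S : local_aut i j p th ->
    (forall x, x \in C -> x \in S -> hamming_aut p th x \in S) ->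
  two_coord_switching (mix C [set hamming_aut p th x | x in C] S) C.
Proof.
move=> /local_autV[ij pE thE] stS; exists i, j, p^-1%g, (aut_inv p th); split=> //.
apply/subsetP => x xC; rewrite !inE xC andbT.
have [xS|//] := boolP (x \in S); apply/orP; right.
apply/imsetP; exists (hamming_aut p th x); last by rewrite hamming_autK.
by rewrite in_setU in_setI stS ?imset_f ?orbT.
Qed.

(** Each step carries switchings in both directions, so that chains can be reversed and two codes
    can be joined through a common target. *)
Inductive linked (P : {set 'rV['F_3]_n} -> Prop) C : {set 'rV['F_3]_n} -> Prop :=
| linked_refl : P C -> linked P C C
| linked_step D E : linked P C D -> two_coord_switching D E ->
    two_coord_switching E D -> P E -> linked P C E.

Lemma linked_target P C D : linked P C D -> P D.
Proof. by case. Qed.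

Lemma linked_trans P C D E : linked P C D -> linked P D E -> linked P C E.
Proof. by move=> CD; elim=> // D' E' _ CD' sw sw' PE'; apply: linked_step CD' sw sw' PE'. Qed.

Lemma linked_sym P C D : linked P C D -> linked P D C.
Proof.
elim=> [PC|{}D E CD IH sw sw' PE]; first exact: linked_refl.
apply: linked_trans IH; apply: linked_step sw' sw (linked_target CD).
exact: linked_refl.
Qed.

Lemma linked_sub (P Q : {set 'rV['F_3]_n} -> Prop) C D :
  (forall E, P E -> Q E) -> linked P C D -> linked Q C D.
Proof.
move=> PQ; elim=> [/PQ|{}D E _ IH sw sw' /PQ]; first exact: linked_refl.
exact: linked_step IH sw sw'.
Qed.

Lemma linked_mix (P : {set 'rV['F_3]_n} -> Prop) i j p th C S : local_aut i j p th ->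
    (forall x, x \in C -> x \in S -> hamming_aut p th x \in S) ->
    P C -> P (mix C [set hamming_aut p th x | x in C] S) ->
  linked P C (mix C [set hamming_aut p th x | x in C] S).
Proof.
move=> loc stS PC; apply: linked_step (linked_refl PC) _ _.
  exact: mix_switching loc.
exact: mix_switchingV loc stS.
Qed.

Lemma linked_sequence P C D : linked P C D ->
  exists k (E : nat -> {set 'rV['F_3]_n}),
    [/\ E 0%N = C, E k = D, forall l, (l <= k)%N -> P (E l)
      & forall l, (l < k)%N -> two_coord_switching (E l) (E l.+1)].
Proof.
elim=> [PC|{}D F _ [k [E [E0 Ek PE swE]]] sw _ PF].
  by exists 0%N, (fun _ => C); split.
exists k.+1, (fun l => if (l <= k)%N then E l else F); split=> // [|l lk|l].
- by rewrite ltnn.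
- by case: ifP => // le_lk; apply: PE.
- rewrite ltnS => lk; rewrite lk; case: ltngtP lk => // [lk _|-> _]; first exact: swE.
  by rewrite Ek.
Qed.

(** Supplies the second coordinate when an automorphism acting on a single coordinate is to be
    presented as a two-coordinate one. *)
Lemma exists_other i : (1 < n)%N -> exists j, i != j.
Proof.
move=> n_gt1; have : (0 < #|[set~ i]|)%N by rewrite cardsC1 card_ord -ltnS prednK // ltnW.
by move=> /card_gt0P[j]; rewrite !inE eq_sym; exists j.
Qed.

Definition at_coord i (f : {perm 'F_3}) : {ffun 'I_n -> {perm 'F_3}} :=
  [ffun k => if k == i then f else 1%g].

Lemma local_aut_coord i j f : i != j -> local_aut i j 1%g (at_coord i f).
Proof.
move=> ij; split=> // l; rewrite !inE negb_or => /andP[/negPf li _]; first exact: perm1.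
by rewrite ffunE li.
Qed.

Lemma aut_coordE i f x k :
  hamming_aut 1%g (at_coord i f) x 0 k = if k == i then f (x 0 k) else x 0 k.
Proof. by rewrite mxE invg1 perm1 ffunE; case: ifP => _; rewrite ?perm1. Qed.

Lemma aut_shiftE i t x :
  hamming_aut 1%g (at_coord i (perm (addIr t))) x = x + t *: unit_row i.
Proof.
apply/rowP => k; rewrite aut_coordE permE !mxE eqxx.
by case: eqP => _; rewrite ?mulr1 // mulr0 addr0.
Qed.

Lemma local_aut_tperm i j : i != j -> local_aut i j (tperm i j) [ffun => 1%g].
Proof.
move=> ij; split=> // l; last by rewrite ffunE.
by rewrite !inE negb_or => /andP[li lj]; rewrite tpermD // eq_sym.
Qed.

(** Written as a translation along e_i - e_j, a swap visibly preserves every function that is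
    constant in that direction. *)
Lemma aut_tpermE i j x :
  hamming_aut (tperm i j) [ffun => 1%g] x =
    x + (x 0 j - x 0 i) *: (unit_row i - unit_row j).
Proof.
apply/rowP => k; rewrite mxE tpermV ffunE perm1 !mxE !eqxx /=.
have [->|->|/eqP/negPf -> /eqP/negPf ->] := tpermP; last by rewrite subr0 mulr0 addr0.
  rewrite eqxx; have [->|_] := eqVneq i j; first by rewrite !subrr mul0r addr0.
  by rewrite subr0 mulr1 addrC subrK.
rewrite eqxx; have [->|_] := eqVneq j i; first by rewrite !subrr mul0r addr0.
by rewrite sub0r mulrN1 opprB addrC subrK.
Qed.

End Automorphisms.

(** * Flats containing a code, and the multiplicities of the rows of their matrices *)

Section Flats.
Local Open Scope ring_scope.
Variables n r : nat.
Implicit Types (x y c u : 'rV['F_3]_n) (C D S A : {set 'rV['F_3]_n}) (i j : 'I_n).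
Implicit Types (K : 'M['F_3]_(n, r)) (s v : 'rV['F_3]_r).
Local Notation e := (@unit_row n).

(** [K] is a transposed parity-check matrix and [s] a syndrome. The rows of [K] are thus the columns
    meant in lemma names below. *)
Definition flat K s : {set 'rV['F_3]_n} := [set x | x *m K == s].

Lemma unit_row_mul K i : e i *m K = row i K.
Proof. by rewrite -rowE. Qed.

Lemma mem_direction C x y :
  x \in C -> y \in C -> x - y \in direction (affine_span C).
Proof.
have spanC z : z \in C -> z \in affine_span C.
  move=> zC; rewrite inE; apply/existsP.
  exists [ffun c => if c == z then 1 else 0]; rewrite (bigD1 z) //= ffunE eqxx.
  rewrite big1 ?addr0 ?eqxx /= => [|c /andP[_ /negPf]]; last by rewrite ffunE => ->.
  rewrite (bigD1 z) //= ffunE eqxx scale1r big1 ?addr0 // => c /andP[_ /negPf].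
  by rewrite ffunE => ->; rewrite scale0r.
move=> xC yC; apply: memv_span; apply/allpairsP.
by exists (x, y); rewrite !mem_enum !spanC.
Qed.

(** The direction of the affine span has dimension at most [n - r], so at least [r] independent
    linear forms vanish on it; these give the columns of [K]. *)
Lemma code_rank_flat C : C != set0 -> (code_rank C + r <= n)%N ->
  exists K s, row_full K /\ C \subset flat K s.
Proof.
move=> /set0Pn[c0 c0C] rkC; set W := direction (affine_span C).
pose B := \matrix_(i < \dim W) tnth (vbasis W) i.
have rkB : (r <= \rank (kermx B^T))%N.
  rewrite mxrank_ker mxrank_tr; have := rank_leq_row B.
  by rewrite /code_rank -/W in rkC; lia.
(* The kernel of [B^T] consists of the forms vanishing on [W]; [pid_mx r] keeps [r] vectors of a
   basis of it. *)
pose K := (pid_mx r *m row_base (kermx B^T) : 'M_(r, n))^T.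
have WK w : w \in W -> w *m K = 0.
  move=> /coord_vbasis ->; rewrite mulmx_suml big1 // => i _.
  rewrite -scalemxAl; suff -> : (vbasis W)`_i *m K = 0 by rewrite scaler0.
  have -> : (vbasis W)`_i = row i B by rewrite rowK (tnth_nth 0).
  rewrite -row_mul; suff -> : B *m K = 0 by rewrite row0.
  apply: trmx_inj; rewrite trmx_mul trmxK trmx0 -mulmxA.
  have /sub_kermxP -> : (row_base (kermx B^T) <= kermx B^T)%MS by rewrite eq_row_base.
  by rewrite mulmx0.
exists K, (c0 *m K); split.
  rewrite /row_full /K mxrank_tr mxrankMfree ?row_base_free // rank_pid_mx //.

apply/subsetP => x xC; rewrite inE -subr_eq0 -mulmxBl WK //.
exact: mem_direction.
Qed.

(** The direction lies in the kernel of multiplication by [K], which has dimension [n - r] by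
    rank-nullity. *)
Lemma flat_code_rank C K s :
  row_full K -> C \subset flat K s -> (code_rank C + r <= n)%N.
Proof.
move=> /eqP rkK /subsetP CA; pose f : 'Hom('rV['F_3]_n, 'rV['F_3]_r) := linfun (mulmxr K).
have spanA x : x \in affine_span C -> x *m K = s.
  rewrite inE => /existsP[a /andP[/eqP a1 /eqP ->]].
  rewrite mulmx_suml -[RHS]scale1r -a1 scaler_suml; apply: eq_bigr => c /CA.
  by rewrite inE -scalemxAl => /eqP ->.
have dir : (direction (affine_span C) <= lker f)%VS.
  apply/span_subvP => w /allpairsP[[x y] []] /=; rewrite !mem_enum => xs ys ->.
  by rewrite memv_ker lfunE /= mulmxBl !spanA // subrr.
have := limg_ker_dim f fullv; rewrite capfv dimvf /dim /= mul1n.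
have -> : limg f = fullv.
  apply/eqP; rewrite eqEsubv subvf; apply/subvP => v _.
  have /submxP[u ->] : (v <= K)%MS by rewrite submx_full // /row_full rkK.
  by apply/memv_imgP; exists u; rewrite ?memvf // lfunE.
rewrite dimvf /dim /= mul1n => {2}<-.
by rewrite leq_add2r; apply: dimvS.
Qed.

Definition fiber_ball K v := [set u in ball 0 | u *m K == v].

(** The ball around 0 consists of 0, the e_i and the - e_i, whose images under [K] are 0, the rows
    and the opposite rows. *)
Lemma card_fiber_ball_columns K v : (0 < n)%N ->
  #|fiber_ball K v| =
    ((v == 0%R) + #|[set i | row i K == v]| + #|[set i | row i K == - v]|)%N.
Proof.
move=> n_gt0.
have ev i j : (e i) 0 j = (j == i)%:R by rewrite mxE eqxx.
have inje : injective e.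
  move=> i j /rowP/(_ i); rewrite !ev eqxx; case: eqVneq => // _ /eqP.
pose P := [set e i | i in [set i | row i K == v]].
pose Q := [set - e i | i in [set i | row i K == - v]].
have -> : fiber_ball K v = (if v == 0 then [set 0] else set0) :|: (P :|: Q).
  apply/setP => u; rewrite !in_setU [LHS]inE; apply/andP/idP.
    case=> /(ballP n_gt0)[i [t ->]]; rewrite add0r -scalemxAl unit_row_mul.
    elim/F3_ind: t => [||]; rewrite ?scale0r ?scale1r ?scaleN1r.
    - by rewrite eq_sym => ->; rewrite inE eqxx.
    - by move=> iv; apply/orP; right; rewrite imset_f ?inE.
    - move=> iv; apply/orP; right; apply/orP; right; apply: imset_f.
      by rewrite inE -(eqP iv) opprK.
  case/or3P => [|/imsetP[i iv ->]|/imsetP[i iv ->]].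
  - case: eqP => [->|_]; rewrite inE // => /eqP ->.
    by rewrite ball_refl mul0mx.
  - by rewrite -[e i]add0r -[e i]scale1r mem_ball_scale add0r scale1r unit_row_mul;
      rewrite inE in iv.
  rewrite inE in iv; rewrite -[- e i]add0r -scaleN1r mem_ball_scale add0r.
  by rewrite -scalemxAl unit_row_mul (eqP iv) scaleN1r opprK.
have PQ : P :&: Q = set0.
  apply/setP => u; rewrite inE in_set0; apply/negP => /andP[].
  move=> /imsetP[i _ ->] /imsetP[j _ /rowP/(_ i)]; rewrite ev eqxx mxE ev.
  by case: eqP => _ /eqP.
rewrite cardsU (_ : _ :&: _ = set0) ?cards0 ?subn0.
  rewrite cardsU PQ cards0 subn0 !card_imset //; last first.
    by move=> i j /oppr_inj/inje.
  by rewrite addnA; case: eqP => _; rewrite ?cards1 ?cards0.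
apply/setP => u; rewrite in_setI in_setU in_set0.
case: eqP => _; rewrite ?in_set0 // in_set1; case: eqP => //= ->.
apply/negP => /orP[] /imsetP[i _ /rowP/(_ i)/esym/eqP]; rewrite !mxE !eqxx.
  by rewrite oner_eq0.
by rewrite oppr_eq0 oner_eq0.
Qed.

(* Double counting of the pairs (c, x) with c in C, x in ball c, x K = s + v. *)
Lemma card_fiber_ball K s v C : (2 * n).+1 = (3 ^ r.+1)%N -> (0 < n)%N ->
  packed C -> row_full K -> C \subset flat K s -> #|fiber_ball K v| = 3%N.
Proof.
move=> n3 n_gt0 pkC fullK /subsetP CA.
have count w : (#|C| * #|fiber_ball K w| = #|flat K (s + w)|)%N.
  rewrite -sum_nat_const -[RHS]sum1_card.
  under [RHS]eq_bigr => x _.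
    rewrite -[1%N](pkC x) -sum1_card.
    under eq_bigl => c do rewrite in_setI.
    over.
  rewrite (exchange_big_dep (mem C)) /=; last by move=> x c _ /andP[].
  apply: eq_bigr => c cC; rewrite sum1dep_card.
  (* Translation by [c] carries the fiber over [w] to the words of the ball of [c] with syndrome
     [s + w]. *)
  rewrite -(card_imset (fiber_ball K w) (addIr c)).
  congr #|pred_of_set _|; apply/setP => x; rewrite [RHS]inE cC /=.
  have /eqP cK : c *m K == s by have := CA _ cC; rewrite inE.
  have inb u : (u + c \in ball c) = (u \in ball 0).
    by rewrite !inE -{1}[c]add0r hdist_sub.
  move: (x - c) (subrK c x) => u <-; rewrite (mem_imset _ _ (addIr c)) ball_sym inb.
  by rewrite [in RHS]inE [LHS]inE andbC mulmxDl cK [s + w]addrC (inj_eq (addIr s)).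
have card_flat w : #|flat K (s + w)| = #|flat K (s + 0)|.
  have /submxP[u wE] : (w <= K)%MS by rewrite submx_full.
  rewrite -(card_imset (flat K (s + 0)) (addIr u)).
  congr #|pred_of_set _|; apply/setP => x.
  move: (x - u) (subrK u x) => y <-; rewrite (mem_imset _ _ (addIr u)) !inE mulmxDl -wE.
  by rewrite addr0 (inj_eq (addIr w)).
have C_gt0 : (0 < #|C|)%N.
  by have [c cC _] := packed_ex 0 pkC; apply/card_gt0P; exists c.
have cst w : #|fiber_ball K w| = #|fiber_ball K 0|.
  apply/eqP; rewrite -(eqn_pmul2l C_gt0); apply/eqP.
  by rewrite !count card_flat.
(* The [3 ^ r] fibers have equal size and partition a ball of [3 ^ r.+1] words. *)
have : (\sum_w #|fiber_ball K w| = (2 * n).+1)%N.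
  rewrite -(card_ball0 n_gt0) -[RHS]sum1_card.
  rewrite (partition_big (fun u => u *m K) xpredT) //=; apply: eq_bigr => w _.
  by rewrite sum1dep_card; congr #|pred_of_set _|; apply/setP => u; rewrite !inE.
under eq_bigr do rewrite cst.
rewrite sum_nat_const card_mx mul1n card_Fp // n3 expnS mulnC => /eqP.
by rewrite eqn_pmul2r ?expn_gt0 // cst => /eqP.
Qed.

(** For [v = 0] the fiber count reads 1 + 2k = 3, where k is the number of zero rows. *)
Lemma card_zero_columns K s C : (2 * n).+1 = (3 ^ r.+1)%N -> (0 < n)%N ->
    packed C -> row_full K -> C \subset flat K s ->
  #|[set i | row i K == 0]| = 1%N.
Proof.
move=> n3 n_gt0 pkC fullK CA.
have := card_fiber_ball 0 n3 n_gt0 pkC fullK CA.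
rewrite card_fiber_ball_columns // oppr0 eqxx -addnA add1n addnn => -[].
by move=> /(congr1 half); rewrite doubleK.
Qed.

Lemma card_columns K s C v : (2 * n).+1 = (3 ^ r.+1)%N -> (0 < n)%N ->
    packed C -> row_full K -> C \subset flat K s -> v != 0 ->
  (#|[set i | row i K == v]| + #|[set i | row i K == - v]|)%N = 3%N.
Proof.
move=> n3 n_gt0 pkC fullK CA /negPf v0.
have := card_fiber_ball v n3 n_gt0 pkC fullK CA.
by rewrite card_fiber_ball_columns // v0 add0n.
Qed.

End Flats.

(** * Codes in one flat with a single zero row and no opposite nonzero rows *)

Section Straightening.
Local Open Scope ring_scope.
Variables (n r : nat) (K : 'M['F_3]_(n, r)) (s : 'rV['F_3]_r) (z : 'I_n).
Implicit Types (x y c u a b : 'rV['F_3]_n) (C D S : {set 'rV['F_3]_n}) (i j k l : 'I_n).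
Local Notation e := (@unit_row n).
Local Notation A := (flat K s).

Hypothesis zero_column : forall i, (row i K == 0) = (i == z).
Hypothesis no_opposite_columns : forall i j, row i K = - row j K -> i = z.

Definition block i j := (i != z) && (row i K == row j K).
Definition move i j := (i != j) && block i j.

Lemma block_sym i j : block i j = block j i.
Proof.
rewrite /block -!zero_column [row j K == row i K]eq_sym.
by case: (eqVneq (row i K) (row j K)) => [->|_]; rewrite ?andbF.
Qed.

Lemma block_trans i j k : block i j -> block j k -> block i k.
Proof. by move=> /andP[iz /eqP ij] /andP[_ jk]; rewrite /block iz ij. Qed.

Lemma block_refl i : i != z -> block i i.
Proof. by move=> iz; rewrite /block iz eqxx. Qed.

Lemma move_sym i j : move i j = move j i.
Proof. by rewrite /move eq_sym block_sym. Qed.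

Lemma blockE i j : block i j -> i = j \/ move i j.
Proof. by rewrite /move; case: eqVneq => [|_ ->]; [left|right]. Qed.

Lemma flatD_z a t : (a + t *: e z \in A) = (a \in A).
Proof.
rewrite !inE mulmxDl -scalemxAl unit_row_mul.
have /eqP -> : row z K == 0 by rewrite zero_column.
by rewrite scaler0 addr0.
Qed.

Lemma flatD_block a i j t : block i j -> (a + t *: (e i - e j) \in A) = (a \in A).
Proof.
move=> /andP[_ /eqP ij]; rewrite !inE mulmxDl -scalemxAl mulmxBl !unit_row_mul ij.
by rewrite subrr scaler0 addr0.
Qed.

Lemma flatD_block1 a i j : block i j -> (a + (e i - e j) \in A) = (a \in A).
Proof. by move=> bij; rewrite -[e i - e j]scale1r flatD_block. Qed.

(** Two words of a ball differ by u e_j - t e_i, and being in the flat forces u times row j to equal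
    t times row i. Apart from multiples of e_z, this leaves only equal rows with t = u. *)
Lemma ball_flat x a b : a \in A -> b \in A -> a \in ball x -> b \in ball x ->
  (exists t, b = a + t *: e z) \/ (exists i j, move i j /\ b = a + (e i - e j)).
Proof.
have n_gt0 : (0 < n)%N by case: n z => [[]|].
move=> aA bA /(ballP n_gt0)[i [t aE]] /(ballP n_gt0)[j [u bE]].
have : t *: row i K = u *: row j K.
  apply/eqP; rewrite -!unit_row_mul !scalemxAl -subr_eq0 -mulmxBl.
  rewrite (_ : _ - _ = a - b); last by rewrite aE bE opprD addrACA subrr add0r.
  by rewrite mulmxBl subr_eq0; move: aA bA; rewrite !inE => /eqP -> /eqP ->.
have {aE bE} -> : b = a + (u *: e j - t *: e i).
  by rewrite aE bE addrACA subrr addr0.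
have scale0 v k : v != 0 -> v *: row k K = 0 -> k = z.
  move=> v0 /eqP; rewrite scaler_eq0 (negPf v0) /= zero_column => /eqP //.
have [->|t0] := eqVneq t 0.
  rewrite !scale0r subr0 => /esym; have [->|u0] := eqVneq u 0.
    by left; exists 0; rewrite !scale0r.
  by move=> /(scale0 _ _ u0) ->; left; exists u.
have [->|u0] := eqVneq u 0.
  rewrite !scale0r => /(scale0 _ _ t0) ->; left; exists (- t).
  by rewrite sub0r scaleNr.
have [->|tu] := eqVneq t u.
  move=> /(scalerI u0) ij; have [-> |nij] := eqVneq i j.
    by left; exists 0; rewrite subrr scale0r.
  have [iz|iz] := eqVneq i z.
    have: row j K == 0 by rewrite -ij zero_column iz.
    by rewrite zero_column => /eqP jz; rewrite iz jz eqxx in nij.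
  have mij : move i j by rewrite /move nij /block iz ij eqxx.
  right; elim/F3_ind: u u0 => // _.
    by exists j, i; rewrite move_sym !scale1r.
  by exists i, j; rewrite !scaleN1r opprK [- e j + _]addrC.
(* The remaining coefficients would make rows [i] and [j] opposite, so both indices are [z]. *)
have -> : u = - t by elim/F3_ind: t t0 tu; elim/F3_ind: u u0 => // *; apply: val_inj.
rewrite scaleNr -scalerN => /(scalerI t0) ij.
have iz := no_opposite_columns ij.
have jz : j = z by apply: (@no_opposite_columns j i); rewrite ij opprK.
by left; exists (- t - t); rewrite iz jz scalerBl scaleNr.
Qed.

(** Constancy is required along exactly the nonzero differences allowed by [ball_flat], so any union
    of level sets is separated. *)
Definition invariant (T : Type) (g : 'rV['F_3]_n -> T) :=
  (forall x t, x \in A -> g (x + t *: e z) = g x) /\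
  (forall x i j, x \in A -> move i j -> g (x + (e i - e j)) = g x).

Lemma invariant_separated (g : 'rV['F_3]_n -> 'F_3) (P : pred 'F_3) :
  invariant g -> separated A [set x | P (g x)].
Proof.
move=> [gz gm] x a b aA bA ax bx; rewrite !inE.
by have [[t ->]|[i [j [mij ->]]]] := ball_flat aA bA ax bx; rewrite ?gz ?gm.
Qed.

Lemma invariant_block (T : Type) (g : 'rV['F_3]_n -> T) x i j t : invariant g ->
  x \in A -> block i j -> g (x + t *: (e i - e j)) = g x.
Proof.
move=> [_ gm] xA /blockE[->|mij]; first by rewrite subrr scaler0 addr0.
elim/F3_ind: t => [||]; rewrite ?scale0r ?addr0 ?scale1r ?scaleN1r ?opprB ?gm //.
by rewrite move_sym.
Qed.

(* On the flat, the t found here is unique; off it, it may not exist. *)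
Definition height C x : 'F_3 := odflt 0 [pick t | x + t *: e z \in C].

Definition slope C i j x := height C (x + (e i - e j)) - height C x.

Section Height.
Variable C : {set 'rV['F_3]_n}.
Hypotheses (pkC : packed C) (CA : C \subset A).

(** The codeword covering [x] lies in the flat. It cannot be [x] plus some e_i - e_j, which is at
    distance 2, so it differs from [x] by a multiple of e_z. *)
Lemma height_mem x : x \in A -> x + height C x *: e z \in C.
Proof.
move=> xA; rewrite /height; case: pickP => //= none; exfalso.
have [c cC cx] := packed_ex x pkC; have cA := subsetP CA c cC.
have [[t cE]|[i [j [mij cE]]]] := ball_flat xA cA (ball_refl x) cx.
  by have := none t; rewrite -cE cC.
move: cx; rewrite inE cE leqNgt; apply/negP/negPn.
move: mij => /andP[ij _].
rewrite /hdist (cardsD1 i) (cardsD1 j) !inE !mxE !eqxx /= [j == i]eq_sym (negPf ij).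
have neqD (u t : 'F_3) : t != 0 -> u != u + t.
  by rewrite -{1}[u]addr0 (inj_eq (addrI _)) eq_sym.
by rewrite !neqD.
Qed.

Lemma height_eq x t : x + t *: e z \in C -> height C x = t.
Proof.
move=> xtC; rewrite /height; case: pickP => [u xuC|/(_ t)]; last by rewrite xtC.
have := packed_uniq pkC xuC xtC (mem_ball_scale _ _ _) (mem_ball_scale _ _ _).
by move=> /addrI/rowP/(_ z); rewrite !mxE !eqxx !mulr1.
Qed.

Lemma mem_height x : x \in A -> (x \in C) = (height C x == 0).
Proof.
move=> xA; apply/idP/eqP => [xC|hx]; first by apply: height_eq; rewrite scale0r addr0.
by have := height_mem xA; rewrite hx scale0r addr0.
Qed.

Lemma height_z x t : x \in A -> height C (x + t *: e z) = height C x - t.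
Proof.
move=> xA; apply: height_eq; rewrite scalerBl -addrA [t *: _ + _]addrC subrK.
exact: height_mem.
Qed.

(** With a common height h, the codewords over both words would lie in the ball centred at x + h e_z
    + e_i. *)
Lemma height_move x i j : x \in A -> move i j ->
  height C (x + (e i - e j)) != height C x.
Proof.
move=> xA mij; have /andP[ij bij] := mij.
have yA : x + (e i - e j) \in A by rewrite flatD_block1.
apply/eqP => hE; have xC := height_mem xA; have yC := height_mem yA.
rewrite hE in yC; set h := _ *: e z in xC yC.
have b1 : x + h \in ball (x + h + e i).
  by rewrite ball_sym -[e i]scale1r mem_ball_scale.
have b2 : x + (e i - e j) + h \in ball (x + h + e i).
  rewrite (_ : _ + h = x + h + e i + (-1) *: e j) ?mem_ball_scale //.
  by rewrite scaleN1r addrAC addrA.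
have /esym/eqP := packed_uniq pkC xC yC b1 b2.
rewrite addrAC -[eqbRHS]addr0 (inj_eq (addrI _)) => /eqP/rowP/(_ i).
by rewrite !mxE !eqxx (negPf ij).
Qed.

Lemma height_move_scale x i j t : x \in A -> move i j -> t != 0 ->
  height C (x + t *: (e i - e j)) != height C x.
Proof.
move=> xA mij; elim/F3_ind: t => // _; first by rewrite scale1r height_move.
by rewrite scaleN1r opprB height_move // move_sym.
Qed.

(* The heights along two moves form a Latin square of order 3. *)
Lemma slope_invariant i j : move i j -> invariant (slope C i j).
Proof.
move=> mij; have /andP[_ bij] := mij; split=> [x t xA|x k l xA mkl].
  rewrite /slope addrAC !height_z // ?flatD_block1 //.
  by rewrite opprB addrA subrK.
have /andP[_ bkl] := mkl.
(* By [height_move_scale] the table [F] has distinct entries in each row and column, even if the two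
   moves share coordinates. *)
pose F p q := height C (x + p *: (e i - e j) + q *: (e k - e l)).
have FE : F 1 1 - F 0 1 = F 1 0 - F 0 0.
  apply: F3_latin => [p p' q pp'|p q q' qq'].
    rewrite /F -[p](subrK p') scalerDl addrA.
    rewrite -(addrA x) (addrC (_ *: _) (p' *: _)) (addrA x).
    by rewrite (addrAC _ (_ *: _) (q *: _)) height_move_scale ?subr_eq0 // !flatD_block.
  rewrite /F -[q](subrK q') scalerDl addrA addrAC.
  by rewrite height_move_scale ?subr_eq0 // !flatD_block.
move: FE; rewrite /F !scale0r !scale1r !addr0 => FE.
by rewrite /slope addrAC FE.
Qed.

Lemma slope_block_invariant i j : block i j -> invariant (slope C i j).
Proof.
move=> /blockE[->|]; last exact: slope_invariant.
by split=> *; rewrite /slope subrr !addr0 !subrr.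
Qed.

(** Invariance lets the second slope be read at x + e_i - e_j, where the two increments
    telescope. *)
Lemma slope_add i j k x : x \in A -> block i j -> block j k ->
  slope C i k x = slope C i j x + slope C j k x.
Proof.
move=> xA bij bjk; have inv := slope_block_invariant bjk.
rewrite -(invariant_block 1 inv xA bij) scale1r /slope [RHS]addrC [RHS]addrA subrK.
by rewrite -addrA [e i - e j + _]addrA subrK.
Qed.

Lemma slope_id i x : slope C i i x = 0.
Proof. by rewrite /slope subrr addr0 subrr. Qed.

Lemma slope_opp i j x : x \in A -> block i j -> slope C j i x = - slope C i j x.
Proof.
move=> xA bij; apply/eqP; rewrite -addr_eq0 -slope_add // ?slope_id //.
by rewrite block_sym.
Qed.

Lemma slope_neq0 i j x : x \in A -> move i j -> slope C i j x != 0.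
Proof. by move=> xA mij; rewrite subr_eq0 height_move. Qed.

Variable lam : 'I_n -> 'F_3.
Hypothesis lam_inj : forall i j, move i j -> lam i != lam j.

(** One correct slope settles its block: 0 and the slopes from [j] and from a third member to [i]
    are distinct, as are the prescribed values, so [F3_third] determines the last one. *)
Lemma slope_block i j k l x : x \in A -> move i j -> block i k -> block i l ->
  slope C i j x = lam i - lam j -> slope C k l x = lam k - lam l.
Proof.
move=> xA mij bik bil ijE; have /andP[_ bij] := mij.
suff toi k' : block i k' -> slope C k' i x = lam k' - lam i.
  rewrite (@slope_add k i l) //; last by rewrite block_sym.
  by rewrite toi // -[slope C i l x]opprK -slope_opp // toi // opprB addrA subrK.
move=> {bik bil k l} bik; case: (eqVneq k' i) => [->|ki]; first by rewrite slope_id subrr.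
have jiE : slope C j i x = lam j - lam i by rewrite slope_opp // ijE opprB.
case: (eqVneq k' j) => [->//|kj].
have mki : move k' i by rewrite /move ki block_sym.
have bkj : block k' j by apply: block_trans bij; rewrite block_sym.
have mkj : move k' j by rewrite /move kj.
have mji : move j i by rewrite move_sym.
rewrite [LHS](@F3_third 0 (slope C j i x)).
- rewrite jiE [RHS](@F3_third 0 (lam j - lam i)) //.
  + by rewrite eq_sym subr_eq0 lam_inj.
  + by rewrite (inj_eq (addIr _)) eq_sym lam_inj.
  + by rewrite eq_sym subr_eq0 lam_inj.
- by rewrite eq_sym slope_neq0.
- have -> : slope C k' i x = slope C k' j x + slope C j i x.
    by apply: slope_add; rewrite // block_sym.
  by rewrite eq_sym -subr_eq0 addrK slope_neq0.
by rewrite eq_sym slope_neq0.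
Qed.

End Height.

Definition in_flat C := packed C /\ C \subset A.

Section Swap.
Variables (C : {set 'rV['F_3]_n}) (i j : 'I_n).
Hypotheses (pkC : packed C) (CA : C \subset A) (mij : move i j).
Variable lam : 'I_n -> 'F_3.
Hypothesis lam_inj : forall k l, move k l -> lam k != lam l.

Let swap := hamming_aut (tperm i j) [ffun => 1%g].
Let S := [set x | slope C i j x != lam i - lam j].

Definition straighten := mix C [set swap x | x in C] S.

Let bij : block i j. Proof. by case/andP: mij. Qed.

Let swap_flat x : (swap x \in A) = (x \in A).
Proof. by rewrite /swap aut_tpermE flatD_block. Qed.

Let swapE x k : swap x 0 k = x 0 (tperm i j k).
Proof. by rewrite mxE tpermV ffunE perm1. Qed.

Let swapK : involutive swap.
Proof. by move=> x; apply/rowP => k; rewrite !swapE tpermK. Qed.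

Let mem_swap x : (x \in [set swap y | y in C]) = (swap x \in C).
Proof. by rewrite -{1}[x]swapK (mem_imset _ _ (can_inj swapK)). Qed.

Let swap_invariant (T : Type) (g : 'rV['F_3]_n -> T) x :
  invariant g -> x \in A -> g (swap x) = g x.
Proof. by move=> inv xA; rewrite /swap aut_tpermE (invariant_block _ inv). Qed.

(** [S] is defined by the invariant slope along [i] and [j], so it is separated and stable under the
    swap. *)
Lemma straighten_linked : linked in_flat C straighten.
Proof.
have swapA : [set swap x | x in C] \subset A.
  by apply/subsetP => _ /imsetP[x xC ->]; rewrite swap_flat (subsetP CA).
apply: linked_mix => //; first exact/local_aut_tperm/(proj1 (andP mij)).
- move=> x xC; rewrite !inE; rewrite -/swap swap_invariant //; first exact: slope_invariant.
  exact: (subsetP CA).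
split.
  apply: (packed_mix pkC _ CA swapA); first exact: packed_aut.
  exact: (@invariant_separated (slope C i j) (fun t => t != lam i - lam j)
    (slope_invariant pkC CA mij)).
by apply/subsetP => x /setUP[/setDP[xC _]|/setIP[xC _]];
  [apply: (subsetP CA)|apply: (subsetP swapA)].
Qed.

Let in_flatS : in_flat straighten. Proof. exact: linked_target straighten_linked. Qed.

Let S_z x t : x \in A -> (x + t *: e z \in S) = (x \in S).
Proof. by move=> xA; rewrite !inE (slope_invariant pkC CA mij).1. Qed.

Lemma height_straighten x : x \in A ->
  height straighten x = if x \in S then height C (swap x) else height C x.
Proof.
have [pkS SA] := in_flatS; move=> xA; apply: height_eq => //.
rewrite in_setU in_setD in_setI !S_z //; case: ifP => xS /=; last first.
  by rewrite andbF orbF height_mem.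
rewrite andbT mem_swap /swap aut_tpermE.
(* Neither [i] nor [j] is [z], so the swap commutes with adding multiples of e_z. *)
have -> : (x + height C (swap x) *: e z) 0 j - (x + height C (swap x) *: e z) 0 i =
    x 0 j - x 0 i.
  have /andP[iz _] := bij; have /andP[jz _] : block j i by rewrite block_sym.
  by rewrite !mxE !eqxx (negPf iz) (negPf jz) !mulr0 !addr0.
by rewrite addrAC -aut_tpermE height_mem // -/swap swap_flat.
Qed.

Let S_move x k l : x \in A -> move k l -> (x + (e k - e l) \in S) = (x \in S).
Proof. by move=> xA mkl; rewrite !inE (slope_invariant pkC CA mij).2. Qed.

Let swap_add x d : swap (x + d) = swap x + swap d.
Proof. by apply/rowP => k; rewrite swapE 2!mxE !swapE. Qed.

(** The slope and its target are both nonzero, so a wrong slope is the opposite of the target, and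
    swapping [i] and [j] negates it. *)
Lemma slope_straighten x : x \in A -> slope straighten i j x = lam i - lam j.
Proof.
move=> xA; rewrite /slope !height_straighten ?flatD_block1 ?S_move //.
case: ifP => xS; last by move: xS; rewrite inE => /negbFE/eqP.
have -> : swap (x + (e i - e j)) = swap x + (e j - e i).
  rewrite swap_add; congr (_ + _); rewrite /swap aut_tpermE !mxE !eqxx.
  have /andP[/negPf ij _] := mij; rewrite [j == i]eq_sym ij /= subr0 sub0r.
  rewrite -[X in X + _]scale1r -scalerDl -[RHS]opprB -[RHS]scaleN1r.
  by congr (_ *: _); apply: val_inj.
rewrite -[LHS]/(slope C j i (swap x)) swap_invariant //; last first.
  by apply: slope_invariant => //; rewrite move_sym.
rewrite slope_opp //; move: xS; rewrite inE.
have := slope_neq0 pkC CA xA mij; have := lam_inj mij; rewrite -subr_eq0.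
elim/F3_ind: (lam i - lam j); elim/F3_ind: (slope C i j x) => // *; exact: val_inj.
Qed.

(** The swap fixes e_k - e_l, so slopes in other blocks are only relocated and no new wrong value
    arises. *)
Lemma slope_straighten_other x k l : x \in A -> move k l -> ~~ block i k ->
  exists2 y, y \in A & slope straighten k l x = slope C k l y.
Proof.
move=> xA mkl nik; have /andP[_ bkl] := mkl.
rewrite /slope !height_straighten ?flatD_block1 ?S_move //.
case: ifP => xS; last by exists x.
exists (swap x); rewrite ?swap_flat // swap_add; congr (height C (_ + _) - _).
have nil : ~~ block i l by apply: contra nik => /block_trans; apply; rewrite block_sym.
have /andP[iz _] := bij; have /andP[jz _] : block j i by rewrite block_sym.
have neq k' : ~~ block i k' -> (i == k' = false) * (j == k' = false).
  by move=> nik'; split; apply: contraNF nik' => /eqP <- //; apply: block_refl.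
by rewrite /swap aut_tpermE !mxE !eqxx !neq //= !subrr scale0r addr0.
Qed.

End Swap.

Section Weights.
Variable lam : 'I_n -> 'F_3.
Hypothesis lam_inj : forall i j, move i j -> lam i != lam j.

Definition bad C := [set ij | move ij.1 ij.2 &&
  [exists x in A, slope C ij.1 ij.2 x != lam ij.1 - lam ij.2]].

(** The whole block of [i] becomes correct by [slope_block], and other blocks inherit slopes already
    present. This is the measure that drives the induction of [straighten_all]. *)
Lemma bad_straighten C i j : packed C -> C \subset A -> (i, j) \in bad C ->
  bad (straighten C i j lam) \proper bad C.
Proof.
move=> pkC CA ijbad; have := ijbad; rewrite inE /= => /andP[mij _].
have /andP[_ bij] := mij.
have [pkS SA] := linked_target (straighten_linked pkC CA mij lam).
have good x : x \in A -> slope (straighten C i j lam) i j x = lam i - lam j.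
  exact: slope_straighten.
apply/properP; split; last first.
  exists (i, j) => //; rewrite inE mij negb_exists_in; apply/forall_inP => x xA.
  by rewrite negbK good.
apply/subsetP => -[k l]; rewrite !inE /= => /andP[mkl /exists_inP[x xA]].
rewrite mkl /=; have [bik|nik] := boolP (block i k).
  rewrite (slope_block pkS SA lam_inj xA mij bik) ?eqxx ?good //.
  by apply: block_trans bik _; case/andP: mkl.
have [y yA ->] := slope_straighten_other pkC CA mij lam xA mkl nik.
by move=> ?; apply/exists_inP; exists y.
Qed.

Lemma straighten_all C : packed C -> C \subset A ->
  exists2 D, linked in_flat C D & bad D = set0.
Proof.
have [m] := ubnP #|bad C|; elim: m C => // m IH C; rewrite ltnS => badC pkC CA.
have [bad0|[[i j] ij]] := set_0Vmem (bad C); first by exists C => //; apply: linked_refl.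
have mij : move i j by move: ij; rewrite inE => /andP[].
have CD := straighten_linked pkC CA mij lam.
have [pkD DA] := linked_target CD.
have [|E DE badE] := IH _ _ pkD DA.
  by apply: leq_trans badC; apply/proper_card/bad_straighten.
by exists E => //; apply: linked_trans DE.
Qed.

Hypothesis lam_z : lam z = -1.
Hypothesis n_gt1 : (1 < n)%N.

(** The linear form whose increments along moves are the prescribed slopes. The value -1 at [z]
    makes it vary along e_z as heights do. *)
Definition weight x := \sum_i lam i * x 0 i.

Lemma weight_add x y : weight (x + y) = weight x + weight y.
Proof. by rewrite -big_split; apply: eq_bigr => i _; rewrite mxE mulrDr. Qed.

Lemma weight_scale t x : weight (t *: x) = t * weight x.
Proof. by rewrite mulr_sumr; apply: eq_bigr => i _; rewrite mxE mulrCA. Qed.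

Lemma weight_unit i : weight (e i) = lam i.
Proof.
rewrite /weight (bigD1 i) //= mxE !eqxx mulr1 big1 ?addr0 // => j /negPf ji.
by rewrite mxE ji mulr0.
Qed.

Lemma weight_z x t : weight (x + t *: e z) = weight x - t.
Proof. by rewrite weight_add weight_scale weight_unit lam_z mulrN1. Qed.

Lemma weight_move x i j : weight (x + (e i - e j)) = weight x + (lam i - lam j).
Proof.
by rewrite !weight_add -[- e j]scaleN1r weight_scale !weight_unit mulN1r.
Qed.

Definition offset_code (g : 'rV['F_3]_n -> 'F_3) := [set x in A | g x + weight x == 0].

(** Once no move is bad, height and weight have the same increments along e_z and along all
    moves. *)
Lemma straight_offset C : packed C -> C \subset A -> bad C = set0 ->
  let g x := height C x - weight x in invariant g /\ C = offset_code g.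
Proof.
move=> pkC CA bad0; split; last first.
  apply/setP => x; rewrite inE subrK; have [xA|xA] := boolP (x \in A).
    by rewrite (mem_height pkC CA).
  by apply: contraNF xA => /(subsetP CA).
split=> [x t xA|x i j xA mij]; first by rewrite height_z // weight_z; ring.
have : (i, j) \notin bad C by rewrite bad0 inE.
rewrite inE /= mij negb_exists_in => /forall_inP/(_ x xA); rewrite negbK => /eqP.
rewrite /slope weight_move => <-; ring.
Qed.

(** On the level set where [g] is [t], shifting coordinate [z] by [- t] turns the equation
    [t + weight x = 0] into [weight x = 0]. *)
Lemma offset_step g (t : 'F_3) : invariant g -> packed (offset_code g) ->
  linked in_flat (offset_code g) (offset_code (fun x => if g x == t then 0 else g x)).
Proof.
move=> invg pkg; have CA : offset_code g \subset A.
  by apply/subsetP => x; rewrite inE => /andP[].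
have [j jz] := exists_other z n_gt1.
pose f := perm (addIr (- t)); pose S := [set x | g x == t].
pose shift := hamming_aut 1%g (at_coord z f).
have shiftE x : shift x = x + (- t) *: e z by rewrite /shift aut_shiftE.
have loc := local_aut_coord f jz.
have shiftA : [set shift x | x in offset_code g] \subset A.
  by apply/subsetP => _ /imsetP[x xC ->]; rewrite shiftE flatD_z (subsetP CA).
have mem_shift x : (x \in [set shift y | y in offset_code g]) =
    (x + t *: e z \in offset_code g).
  apply/imsetP/idP => [[y yC ->]|xC]; first by rewrite shiftE scaleNr subrK.
  by exists (x + t *: e z); rewrite ?shiftE // scaleNr addrK.
have -> : offset_code (fun x => if g x == t then 0 else g x) =
    mix (offset_code g) [set shift x | x in offset_code g] S.
  apply/setP => x; rewrite in_setU in_setD in_setI mem_shift !inE.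
  have [xA|xA] := boolP (x \in A); last first.
    have := xA; rewrite inE => /negPf ->; rewrite andbF /=.
    by have := flatD_z x t; rewrite [in RHS](negPf xA) inE => ->.
  have := xA; rewrite inE => -> /=; have := flatD_z x t; rewrite xA inE => -> /=.
  rewrite invg.1 // weight_z; case: (g x =P t) => [->|_] /=; last by rewrite andbF orbF.
  by rewrite andbT add0r addrCA subrr addr0.
have in_flatC : in_flat (offset_code g) by [].
apply: (linked_mix loc) => //.
  move=> x xC; rewrite !inE -/shift shiftE invg.1 //; exact: (subsetP CA).
split; first apply: (packed_mix pkg _ CA shiftA) => //.
  exact: packed_aut.
  exact: (@invariant_separated g (pred1 t) invg).
by apply/subsetP => x /setUP[/setDP[xC _]|/setIP[xC _]];
  [apply: (subsetP CA)|apply: (subsetP shiftA)].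
Qed.

(** After straightening, the two nonzero offsets 1 and -1 are cleared in turn. The resulting affine
    code does not depend on [C]. *)
Theorem linked_offset0 C : packed C -> C \subset A ->
  linked in_flat C (offset_code (fun=> 0)).
Proof.
move=> pkC CA; have [D CD badD] := straighten_all pkC CA.
have [pkD DA] := linked_target CD; apply: linked_trans CD _.
have [] := straight_offset pkD DA badD; set g := fun x => _ => invg DE.
rewrite DE; rewrite DE in pkD.
have step1 := offset_step 1 invg pkD; apply: (linked_trans step1).
set g1 := fun x => _ in step1 *.
have invg1 : invariant g1.
  by case: invg => gz gm; split=> *; rewrite /g1 ?gz ?gm.
have [pk1 _] := linked_target step1.
have := offset_step (-1) invg1 pk1; congr (linked _ _ _).
apply/setP => x; rewrite !inE /g1; congr (_ && (_ + _ == _)).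
by elim/F3_ind: (g x).
Qed.

End Weights.
End Straightening.

(** * Changing the matrix and the syndrome of a flat by switchings *)

Section Equivalence.
Local Open Scope ring_scope.
Variables n r : nat.
Implicit Types (C D : {set 'rV['F_3]_n}) (i j k : 'I_n) (x u : 'rV['F_3]_n).
Implicit Types (K : 'M['F_3]_(n, r)) (s v : 'rV['F_3]_r).
Local Notation e := (@unit_row n).

Definition flat_code C := packed C /\ exists K s, row_full K /\ C \subset flat K s.

Lemma in_flat_code K s C : row_full K -> in_flat K s C -> flat_code C.
Proof. by move=> fullK [pkC CA]; split=> //; exists K, s. Qed.

(** Moving a whole code by a two-coordinate automorphism is the switching whose region is the full
    space. *)
Lemma linked_aut i j p th C K s K' s' : local_aut i j p th ->
    row_full K -> in_flat K s C -> row_full K' ->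
    (forall x, x \in C -> hamming_aut p th x \in flat K' s') ->
  exists2 D, linked flat_code C D & in_flat K' s' D.
Proof.
move=> loc fullK inC fullK' imC; set D := [set hamming_aut p th x | x in C].
have inD : in_flat K' s' D.
  split; first exact: packed_aut inC.1.
  by apply/subsetP => _ /imsetP[x xC ->]; apply: imC.
have mixT : mix C D setT = D by rewrite /mix setDT set0U setIT.
exists D => //; rewrite -mixT; apply: (linked_mix loc) => [x _ _||].
- by rewrite inE.
- exact: in_flat_code inC.
- by rewrite -/D mixT; apply: in_flat_code inD.
Qed.

Lemma row_full_sub K K' :
  row_full K -> (forall i, row i K <= K')%MS -> row_full K'.
Proof. by rewrite -!sub1mx => K1 /row_subP KK'; apply: submx_trans K1 KK'. Qed.

(** The permutation is a product of transpositions, and each of them swaps two coordinates together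
    with the corresponding rows. *)
Lemma linked_permute (p : {perm 'I_n}) C K s : row_full K -> in_flat K s C ->
  row_full (row_perm p K) /\
  exists2 D, linked flat_code C D & in_flat (row_perm p K) s D.
Proof.
move=> fullK inC; have [ts -> tsP] := prod_tpermP p; elim: ts tsP => [_|[i j] ts IH].
  rewrite big_nil row_perm1; split=> //; exists C => //.
  exact: linked_refl (in_flat_code fullK inC).
rewrite /= => /andP[ij /IH[fullK1 [D CD inD]]]; rewrite big_cons row_permM.
move: (row_perm _ K) fullK1 inD => K1 fullK1 inD.
have rowK2 k : row k (row_perm (tperm i j) K1) = row (tperm i j k) K1.
  by apply/rowP => l; rewrite !mxE.
have fullK2 : row_full (row_perm (tperm i j) K1).
  apply: row_full_sub fullK1 _ => k.
  by rewrite -[k](tpermK i j) -rowK2 row_sub.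
split=> //.
have [x xD|E DE inE'] := linked_aut (s' := s) (local_aut_tperm ij) fullK1 inD fullK2.
  have /eqP <- : x *m K1 == s by have := subsetP inD.2 _ xD; rewrite inE.
  rewrite inE !mulmx_sum_row (reindex_inj (@perm_inj _ (tperm i j))); apply/eqP.
  by apply: eq_bigr => k _; rewrite rowK2 tpermK hamming_autE ffunE perm1.
by exists E => //; apply: linked_trans DE.
Qed.

(** Full rank gives [u] with [s' - s = u *m K]; the translation by [u] is made one coordinate at a
    time. *)
Lemma linked_translate s' C K s : (1 < n)%N -> row_full K -> in_flat K s C ->
  exists2 D, linked flat_code C D & in_flat K s' D.
Proof.
move=> n_gt1 fullK; have [u uE] : exists u : 'rV_n, s' = s + u *m K.
  have /submxP[u uE] : (s' - s <= K)%MS by rewrite submx_full.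
  by exists u; rewrite -uE addrC subrK.
rewrite {s'}uE [u]row_sum_delta.
elim/big_ind: _ s C => [|v w IHv IHw|i _] s C inC.
- by exists C; rewrite ?mul0mx ?addr0 //; exact: linked_refl (in_flat_code fullK inC).
- have [D CD inD] := IHv _ _ inC; have [E DE inE'] := IHw _ _ inD.
  by exists E; [apply: linked_trans DE|rewrite mulmxDl addrA].
have [j ij] := exists_other i n_gt1.
have loc := local_aut_coord (perm (addIr (u 0 i))) ij.
apply: (linked_aut loc fullK inC fullK) => x xC; rewrite aut_shiftE inE mulmxDl.
by have := subsetP inC.2 _ xC; rewrite inE => /eqP ->.
Qed.

(* Exactly one of v, - v is normal when v != 0; the order used is arbitrary. *)
Definition normal_vector v := (enum_rank v <= enum_rank (- v))%N.

Definition normal_matrix K := [forall i, normal_vector (row i K)].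

Lemma normal_vectorN v : ~~ normal_vector v -> normal_vector (- v).
Proof. by rewrite /normal_vector opprK -ltnNge => /ltnW. Qed.

Lemma normal_vector_eq0 v : normal_vector v -> normal_vector (- v) -> v = 0.
Proof.
rewrite /normal_vector opprK => le1 le2.
have /val_inj/enum_rank_inj vN : enum_rank v = enum_rank (- v) :> nat.
  by apply/eqP; rewrite eqn_leq le1.
apply/rowP => i; have := congr1 (fun w : 'rV_r => w 0 i) vN; rewrite !mxE.
by elim/F3_ind: (v 0 i).
Qed.

(** Negating the letters at coordinate [i] and row [i] together preserves the syndrome; the
    induction is on the number of rows that are not normal. *)
Lemma linked_normalize C K s : (1 < n)%N -> row_full K -> in_flat K s C ->
  exists D K', [/\ linked flat_code C D, row_full K', in_flat K' s D & normal_matrix K'].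
Proof.
move=> n_gt1; pose odd_rows K := [set i | ~~ normal_vector (row i K)].
have [m] := ubnP #|odd_rows K|; elim: m K C => // m IH K C; rewrite ltnS => oddK.
move=> fullK inC; have [odd0|[i]] := set_0Vmem (odd_rows K).
  exists C, K; split=> //; first exact: linked_refl (in_flat_code fullK inC).
  by apply/forallP => i; apply/negPn; have := in_set0 i; rewrite -odd0 inE => ->.
rewrite inE => iodd; pose K' := \matrix_(k < n) (if k == i then - row k K else row k K).
have rowK' k : row k K' = if k == i then - row k K else row k K by rewrite rowK.
have fullK' : row_full K'.
  apply: row_full_sub fullK _ => k; have := row_sub k K'; rewrite rowK'.
  by case: eqP => // _ sub; rewrite -[row k K]opprK -scaleN1r scalemx_sub.
have [j ij] := exists_other i n_gt1.
have loc := local_aut_coord (perm oppr_inj) ij.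
have [x xC|D CD inD] := linked_aut (s' := s) loc fullK inC fullK'.
  have /eqP <- : x *m K == s by have := subsetP inC.2 _ xC; rewrite inE.
  rewrite inE !mulmx_sum_row; apply/eqP/eq_bigr => k _; rewrite rowK' aut_coordE permE.
  by case: eqP => _ //; rewrite scaleNr scalerN opprK.
have [|E [L [DE fullL inE' nL]]] := IH K' D _ fullK' inD.
  apply: leq_trans oddK; apply/proper_card/properP; split.
    apply/subsetP => k; rewrite !inE rowK'; case: eqP => // -> /negP[].
    exact: normal_vectorN.
  exists i; rewrite !inE // rowK' eqxx negbK; exact: normal_vectorN.
by exists E, L; split=> //; apply: linked_trans DE.
Qed.

End Equivalence.

(** * Normal matrices are unique up to a permutation of rows *)

Section NormalMatrix.
Local Open Scope ring_scope.
Variables n r : nat.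
Hypotheses (n_gt1 : (1 < n)%N) (n3 : (2 * n).+1 = (3 ^ r.+1)%N).
Implicit Types (C D : {set 'rV['F_3]_n}) (i j k : 'I_n) (x u : 'rV['F_3]_n).
Implicit Types (K : 'M['F_3]_(n, r)) (s v : 'rV['F_3]_r).

(** Only one of [v] and [- v] can occur, so it takes all three occurrences. The multiset of rows is
    thus the same for all such matrices. *)
Lemma normal_card_columns K s C v : row_full K -> in_flat K s C -> normal_matrix K ->
  #|[set i | row i K == v]| = if v == 0 then 1%N else if normal_vector v then 3%N else 0%N.
Proof.
move=> fullK [pkC CA] /forallP nK; have n_gt0 := ltnW n_gt1.
have none w : ~~ normal_vector w -> #|[set i | row i K == w]| = 0%N.
  move=> nw; apply/eqP; rewrite cards_eq0 -subset0; apply/subsetP => i.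
  by rewrite inE => /eqP wE; rewrite -wE nK in nw.
case: eqVneq => [->|v0]; first exact: card_zero_columns pkC fullK CA.
case: ifPn => nv; last exact: none.
have := card_columns n3 n_gt0 pkC fullK CA v0; rewrite [X in (_ + X)%N]none ?addn0 //.
by apply: contra v0 => nNv; apply/eqP/normal_vector_eq0.
Qed.

Lemma count_rows K v :
  count_mem v [tuple row i K | i < n] = #|[set i | row i K == v]|.
Proof.
rewrite count_map cardE /enum_mem size_filter /= enumT.
by apply: eq_count => i; rewrite /= inE.
Qed.

Lemma normal_permute K s C K' s' C' :
    row_full K -> in_flat K s C -> normal_matrix K ->
    row_full K' -> in_flat K' s' C' -> normal_matrix K' ->
  exists p, K' = row_perm p K.
Proof.
move=> fK inC nK fK' inC' nK'.
have /tuple_permP[p pE] : perm_eq [tuple row i K' | i < n] [tuple row i K | i < n].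
  apply/allP => v _; rewrite /= !count_rows.
  by rewrite (normal_card_columns _ fK inC nK) (normal_card_columns _ fK' inC' nK').
exists p; apply/row_matrixP => i.
have := congr1 (fun t => tnth t i) (val_inj pE); rewrite !tnth_mktuple => ->.
by apply/rowP => j; rewrite !mxE.
Qed.

Lemma weights_exist K s C z : (forall i, (row i K == 0) = (i == z)) ->
    row_full K -> in_flat K s C -> normal_matrix K ->
  exists lam : 'I_n -> 'F_3, lam z = -1 /\
    forall i j, move K z i j -> lam i != lam j.
Proof.
move=> zcol fK inC nK; pose B i := enum [set k | row k K == row i K].
(* Each block has three members, so their positions in a list of the block remain distinct modulo
   3. *)
exists (fun i => if i == z then -1 else (index i (B i))%:R); rewrite eqxx; split=> // i j.
move=> /andP[ij bij]; have /andP[/negPf iz /eqP rij] := bij.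
have jz : (j == z) = false by rewrite -zcol -rij zcol.
rewrite iz jz; have Bj : B j = B i by rewrite /B rij.
have lt3 k : k \in B i -> (index k (B i) < 3)%N.
  rewrite -index_mem => /leq_trans; apply; rewrite -cardE.
  by rewrite (normal_card_columns _ fK inC nK); do 2?case: ifP.
have iB : i \in B i by rewrite mem_enum inE.
have jB : j \in B i by rewrite mem_enum inE rij.
rewrite Bj; apply: contra ij => /eqP/(congr1 val).
rewrite /= !val_Fp_nat // !modn_small ?lt3 // => eq_index.
by apply/eqP; apply: (@index_inj _ i (B i)) eq_index.
Qed.

(** Both codes are linked to the affine code given by the same weights. *)
Lemma linked_normal K s C D : row_full K -> normal_matrix K ->
  in_flat K s C -> in_flat K s D -> linked (flat_code r) C D.
Proof.
move=> fK nK inC inD; have [pkC CA] := inC; have [pkD DA] := inD.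
have := normal_card_columns 0 fK inC nK; rewrite eqxx => /eqP/cards1P[z zE].
have zcol i : (row i K == 0) = (i == z) by have := in_set1 i z; rewrite -zE inE.
have noopp i j : row i K = - row j K -> i = z.
  move=> ij; apply/eqP; rewrite -zcol; apply/eqP/normal_vector_eq0.
    exact: (forallP nK).
  by rewrite ij opprK; apply: (forallP nK).
have [lam [lamz lam_inj]] := weights_exist zcol fK inC nK.
have toL E := linked_offset0 zcol noopp lam_inj lamz n_gt1 (C := E).
have CL := toL s C pkC CA; have DL := toL s D pkD DA.
apply: (@linked_sub _ (in_flat K s)); first by move=> E; apply: in_flat_code.
by apply: linked_trans CL _; apply: linked_sym.
Qed.

(** Both matrices are normalized; then the first code is permuted and translated into the flat of
    the second. *)
Lemma linked_flat_codes C D : flat_code r C -> flat_code r D -> linked (flat_code r) C D.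
Proof.
move=> [pkC [K [s [fK CA]]]] [pkD [L [t [fL DA]]]].
have [C1 [K1 [CC1 fK1 inC1 nK1]]] := linked_normalize n_gt1 fK (conj pkC CA).
have [D1 [L1 [DD1 fL1 inD1 nL1]]] := linked_normalize n_gt1 fL (conj pkD DA).
have [p pE] := normal_permute fK1 inC1 nK1 fL1 inD1 nL1.
have [_ [C2 C12 inC2]] := linked_permute p fK1 inC1.
rewrite -pE in inC2; have [C3 C23 inC3] := linked_translate t n_gt1 fL1 inC2.
apply: linked_trans CC1 _; apply: linked_trans C12 _; apply: linked_trans C23 _.
by apply: linked_trans (linked_sym DD1); apply: (linked_normal fL1 nL1 inC3 inD1).
Qed.

End NormalMatrix.

(** * Numerical facts and the connectedness theorem *)

Lemma half_pow3 m n : n = (3 ^ m - 1) %/ 2 -> (2 * n).+1 = 3 ^ m.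
Proof. 
move=> ->; have odd3 : odd (3 ^ m) by rewrite oddX orbT.
have := odd_double_half (3 ^ m); rewrite odd3 add1n => <-.
by rewrite subn1 divn2 doubleK mul2n.
Qed.

Lemma double_lt_pow3 m : 2 * m < 3 ^ m.
Proof. by elim: m => // m IH; rewrite expnS; lia. Qed.

Theorem theorem3 (m n : nat) (hm : 2 <= m) (hn : n = (3 ^ m - 1) %/ 2)
    (C C' : {set 'rV['F_3]_n})
    (hC : perfect1 C) (hCr : code_rank C <= n - m + 1)
    (hC' : perfect1 C') (hCr' : code_rank C' <= n - m + 1) :
  exists (k : nat) (D : nat -> {set 'rV['F_3]_n}),
    [/\ D 0 = C,
        D k = C',
        forall l, l <= k -> perfect1 (D l) /\ code_rank (D l) <= n - m + 1
      & forall l, l < k -> two_coord_switching (D l) (D l.+1)].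
Proof.
(* With [m = r + 1] the rank bound is [n - r], which corresponds to flats given by [r] equations. *)
case: m hm hn hCr hCr' => // r r_gt0 hn hCr hCr'.
have n3 := half_pow3 hn.
(* This ensures that the subtraction [n - r.+1] is not truncated. *)
have lt_rn : r < n by have := double_lt_pow3 r.+1; rewrite -n3; lia.
have n_gt1 : 1 < n by lia.
have in_code (E : {set 'rV_n}) : perfect1 E -> code_rank E <= n - r.+1 + 1 -> flat_code r E.
  move=> /perfect1P pkE rkE; split=> //; apply: code_rank_flat; last by lia.
  by have [c cE _] := packed_ex 0%R pkE; apply/set0Pn; exists c.
have [k [D [D0 Dk codeD swD]]] := linked_sequence
  (linked_flat_codes n_gt1 n3 (in_code C hC hCr) (in_code C' hC' hCr')).
exists k, D; split=> // l /codeD[pkD [K [s [fK DA]]]]; split; first exact/perfect1P.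
by have := flat_code_rank fK DA; lia.
Qed.
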